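(* Let $(\mathfrak{g}_0,\sigma)$ be a non-compact semisimple symmetric pair and let $(\mathfrak{g},\theta_1,\theta_2)$ be its dual commutative compact semisimple symmetric triad. Then the compact Lie algebra $\mathfrak{g}$ is simple if and only if the non-compact real Lie algebra $\mathfrak{g}_0$ is simple and has no complex structures.
   Context: An involution on a real Lie algebra $\mathfrak{l}$ is an automorphism $\nu$ with $\nu^2=\operatorname{id}$; $\mathfrak{l}^{\pm\nu}$ are its $(\pm1)$-eigenspaces. A non-compact semisimple symmetric pair $(\mathfrak{g}_0,\sigma)$ consists of a non-compact real semisimple Lie algebra $\mathfrak{g}_0$ and an involution $\sigma$ on it. Its dual is $(\mathfrak{g},\theta_1,\theta_2)$ where, for a Cartan involution $\theta$ of $\mathfrak{g}_0$ commuting with $\sigma$ (one exists, and the result is independent of the choice up to isomorphism intertwining the involutions), $\mathfrak{g}:=\mathfrak{g}_0^{\theta}+\sqrt{-1}\mathfrak{g}_0^{-\theta}\subset(\mathfrak{g}_0)_{\mathbb{C}}$, and $\theta_1:=\theta|_{\mathfrak{g}}$, $\theta_2:=\sigma|_{\mathfrak{g}}$ are restrictions of the $\mathbb{C}$-linear extensions of $\theta,\sigma$. A complex structure on a real Lie algebra is an $\mathbb{R}$-linear $J$ with $J^2=-\operatorname{id}$ and $[JX,Y]=J[X,Y]$. *)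

(* Defs.v *)
From HB Require Import structures.
From mathcomp Require Import all_boot all_order all_algebra.
From mathcomp Require Import reals.

Set Implicit Arguments.
Unset Strict Implicit.
Unset Printing Implicit Defensive.

Import GRing.Theory Num.Theory passmx.
Local Open Scope ring_scope.

HB.mixin Record Vector_isLieAlgebra (K : fieldType) L of Vector K L := {
  lie : L -> L -> L;
  lie_linearl : forall a x y z, lie (a *: x + y) z = a *: lie x z + lie y z;
  lie_linearr : forall a x y z, lie z (a *: x + y) = a *: lie z x + lie z y;
  liexx : forall x, lie x x = 0;
  lie_jacobi : forall x y z,
    lie x (lie y z) + lie y (lie z x) + lie z (lie x y) = 0
}.

#[short(type="lieAlgType")]
HB.structure Definition LieAlgebra (K : fieldType) :=
  { L of Vector_isLieAlgebra K L & Vector K L }.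

Section LieTheory.
Variables (K : fieldType) (L : lieAlgType K).
Implicit Types (x y : L) (U V : {vspace L}).

HB.instance Definition _ x := GRing.isSemilinear.Build K L L *:%R (lie x)
  (GRing.semilinear_linear (fun a y z => lie_linearr a y z x)).

Definition ad x : 'End(L) := linfun (lie x).

Definition killing x y : K :=
  \tr (mxof (vbasis {:L}) (vbasis {:L}) (ad x \o ad y)%VF).

Definition lie_ideal U : Prop := forall x y, y \in U -> lie x y \in U.

Definition lie_abelian : Prop := forall x y, lie x y = 0.

Definition lie_simple : Prop :=
  ~ lie_abelian /\ forall U, lie_ideal U -> U = 0%VS \/ U = fullv.

Definition lie_commutator U V : {vspace L} :=
  <<[seq lie u v | u <- vbasis U, v <- vbasis V]>>%VS.

Definition derived_series n U : {vspace L} :=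
  iter n (fun W => lie_commutator W W) U.

Definition solvable_ideal U : Prop :=
  lie_ideal U /\ exists n, derived_series n U = 0%VS.

(* The radical, i.e. the largest solvable ideal, vanishes. *)
Definition lie_semisimple : Prop := forall U, solvable_ideal U -> U = 0%VS.

Definition complex_structure (J : 'End(L)) : Prop :=
  (forall x, J (J x) = - x) /\ (forall x y, lie (J x) y = J (lie x y)).

Record involution := Involution {
  invol_fun :> 'End(L);
  involM : forall x y, invol_fun (lie x y) = lie (invol_fun x) (invol_fun y);
  involK : forall x, invol_fun (invol_fun x) = x
}.

Definition commuting (mu nu : involution) : Prop :=
  forall x, mu (nu x) = nu (mu x).

Record subalgebra := Subalgebra {
  subalg_vs :> {vspace L};
  subalg_closed : forall x y,
    x \in subalg_vs -> y \in subalg_vs -> lie x y \in subalg_vs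
}.

Lemma lieDl x y z : lie (x + y) z = lie x z + lie y z.
Proof. by have := lie_linearl 1 x y z; rewrite !scale1r. Qed.

Lemma lieDr z x y : lie z (x + y) = lie z x + lie z y.
Proof. exact: (raddfD (lie z)). Qed.

Lemma lie0r x : lie x 0 = 0.
Proof. exact: (raddf0 (lie x)). Qed.

Lemma lieNr x y : lie x (- y) = - lie x y.
Proof. exact: (raddfN (lie x)). Qed.

Lemma lieBr z x y : lie z (x - y) = lie z x - lie z y.
Proof. exact: (raddfB (lie z)). Qed.

Lemma lieZr a x y : lie x (a *: y) = a *: lie x y.
Proof. by have := lie_linearr a y 0 x; rewrite !addr0 lie0r addr0. Qed.

Lemma lie_antisym x y : lie x y = - lie y x.
Proof.
apply/eqP; rewrite -addr_eq0; have := liexx (x + y).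
by rewrite lieDl !lieDr !liexx add0r addr0 => ->.
Qed.

Lemma lieNl x y : lie (- x) y = - lie x y.
Proof. by rewrite lie_antisym lieNr -lie_antisym lie_antisym. Qed.

Lemma lieBl x y z : lie (x - y) z = lie x z - lie y z.
Proof. by rewrite lieDl lieNl. Qed.

Lemma lieZl a x y : lie (a *: x) y = a *: lie x y.
Proof. by rewrite lie_antisym lieZr -scalerN -lie_antisym. Qed.

Lemma mem_leigenspace (f : 'End(L)) a x :
  (x \in leigenspace f a) = (f x == a *: x).
Proof.
by rewrite memv_ker add_lfunE opp_lfunE scale_lfunE id_lfunE subr_eq0.
Qed.

End LieTheory.

Arguments lie_simple {K} L.
Arguments lie_abelian {K} L.
Arguments lie_semisimple {K} L.
Arguments involution {K} L.
Arguments subalgebra {K} L.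

Section SubLie.
Variables (K : fieldType) (L : lieAlgType K) (U : subalgebra L).

Definition sub_lie_type : Type := subvs_of U.
HB.instance Definition _ := Vector.on sub_lie_type.

Definition sub_lie (x y : sub_lie_type) : sub_lie_type :=
  vsproj U (lie (vsval x) (vsval y)).

Lemma sub_lie_inj (x y : sub_lie_type) : vsval x = vsval y -> x = y.
Proof. exact: val_inj. Qed.

Lemma val_sub_lie x y : vsval (sub_lie x y) = lie (vsval x) (vsval y).
Proof. by rewrite vsprojK // subalg_closed ?subvsP. Qed.

Lemma val_sub_lieP a (x y : sub_lie_type) :
  vsval (a *: x + y) = a *: vsval x + vsval y.
Proof. exact: (linearP (@vsval _ _ U)). Qed.

Lemma val_sub_lieD (x y : sub_lie_type) :
  vsval (x + y) = vsval x + vsval y.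
Proof. exact: (linearD (@vsval _ _ U)). Qed.

Fact sub_lie_linearl a x y z :
  sub_lie (a *: x + y) z = a *: sub_lie x z + sub_lie y z.
Proof.
by apply: sub_lie_inj; rewrite !(val_sub_lie, val_sub_lieP) lie_linearl.
Qed.

Fact sub_lie_linearr a x y z :
  sub_lie z (a *: x + y) = a *: sub_lie z x + sub_lie z y.
Proof.
by apply: sub_lie_inj; rewrite !(val_sub_lie, val_sub_lieP) lie_linearr.
Qed.

Fact sub_liexx x : sub_lie x x = 0.
Proof. by apply: sub_lie_inj; rewrite val_sub_lie liexx. Qed.

Fact sub_lie_jacobi x y z :
  sub_lie x (sub_lie y z) + sub_lie y (sub_lie z x) + sub_lie z (sub_lie x y)
  = 0.
Proof.
by apply: sub_lie_inj; rewrite !(val_sub_lie, val_sub_lieD) lie_jacobi.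
Qed.

HB.instance Definition _ := Vector_isLieAlgebra.Build K sub_lie_type
  sub_lie_linearl sub_lie_linearr sub_liexx sub_lie_jacobi.

Definition sub_lie_alg : lieAlgType K := sub_lie_type.

Variables (f : involution L) (fU : forall x, x \in U -> f x \in U).

Definition restrict_fun : 'End(sub_lie_alg) :=
  (linfun (vsproj U) \o f \o linfun vsval)%VF.

Lemma val_restrict (x : sub_lie_alg) : vsval (restrict_fun x) = f (vsval x).
Proof. by rewrite !comp_lfunE !lfunE /= vsprojK ?fU ?subvsP. Qed.

Fact restrictM (x y : sub_lie_alg) :
  restrict_fun (lie x y) = lie (restrict_fun x) (restrict_fun y).
Proof.
by apply: sub_lie_inj; rewrite [LHS]val_restrict !val_sub_lie involM !val_restrict.
Qed.

Fact restrictK (x : sub_lie_alg) : restrict_fun (restrict_fun x) = x.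
Proof. by apply: sub_lie_inj; rewrite !val_restrict involK. Qed.

Definition restrict : involution sub_lie_alg :=
  Involution restrictM restrictK.

End SubLie.

(* [cplx_type L] is [L (x)_R C] seen as a real Lie algebra: the pair [(x, y)] stands
   for [x + sqrt(-1) y]. *)
Section Complexification.
Variables (K : fieldType) (L : lieAlgType K).

Definition cplx_type : Type := (L * L)%type.
HB.instance Definition _ := Vector.on cplx_type.

Definition cplx_lie (u v : cplx_type) : cplx_type :=
  (lie u.1 v.1 - lie u.2 v.2, lie u.1 v.2 + lie u.2 v.1).

Fact cplx_lie_linearl a x y z :
  cplx_lie (a *: x + y) z = a *: cplx_lie x z + cplx_lie y z.
Proof.
case: x y z => [x1 x2] [y1 y2] [z1 z2]; congr pair => /=;
  rewrite !lie_linearl ?scalerBr ?scalerDr ?opprD addrACA //.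
Qed.

Fact cplx_lie_linearr a x y z :
  cplx_lie z (a *: x + y) = a *: cplx_lie z x + cplx_lie z y.
Proof.
case: x y z => [x1 x2] [y1 y2] [z1 z2]; congr pair => /=;
  rewrite !lie_linearr ?scalerBr ?scalerDr ?opprD addrACA //.
Qed.

Fact cplx_liexx x : cplx_lie x x = 0.
Proof.
case: x => [x1 x2]; congr pair => /=; first by rewrite !liexx subrr.
by rewrite (lie_antisym x1) addNr.
Qed.

Fact cplx_lie_jacobi x y z :
  cplx_lie x (cplx_lie y z) + cplx_lie y (cplx_lie z x)
    + cplx_lie z (cplx_lie x y) = 0.
Proof.
case: x y z => [x1 x2] [y1 y2] [z1 z2].
congr pair; rewrite /= !(lieBr, lieDr) ?(opprD, addrA).
  rewrite (ACl ((1*5*9)*(2*8*11)*(3*6*12)*(4*7*10))) /= -!opprD.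
  by rewrite !lie_jacobi oppr0 !addr0.
rewrite (ACl ((1*6*11)*(2*7*9)*(3*5*10)*(4*8*12))) /= -!opprD.
by rewrite !lie_jacobi oppr0 !addr0.
Qed.

HB.instance Definition _ := Vector_isLieAlgebra.Build K cplx_type
  cplx_lie_linearl cplx_lie_linearr cplx_liexx cplx_lie_jacobi.

Definition cplx : lieAlgType K := cplx_type.

Definition cplx_in_fun (x : L) : cplx := (x, 0).

Fact cplx_in_linear : linear cplx_in_fun.
Proof. by move=> a x y; congr pair; rewrite /= scaler0 addr0. Qed.
HB.instance Definition _ := GRing.isSemilinear.Build K L cplx *:%R cplx_in_fun
  (GRing.semilinear_linear cplx_in_linear).

Definition cplx_in : 'Hom(L, cplx) := linfun cplx_in_fun.

(* Multiplication by [sqrt(-1)]. *)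
Definition cplx_i_fun (u : cplx) : cplx := (- u.2, u.1).

Fact cplx_i_linear : linear cplx_i_fun.
Proof. by move=> a x y; congr pair; rewrite /= opprD scalerN. Qed.
HB.instance Definition _ := GRing.isSemilinear.Build K cplx cplx *:%R cplx_i_fun
  (GRing.semilinear_linear cplx_i_linear).

Definition cplx_i : 'End(cplx) := linfun cplx_i_fun.

(* The C-linear extension of [f]. *)
Definition cplx_ext_fun (f : 'End(L)) (u : cplx) : cplx := (f u.1, f u.2).

Fact cplx_ext_linear f : linear (cplx_ext_fun f).
Proof. by move=> a x y; congr pair; rewrite /= linearP. Qed.
HB.instance Definition _ f := GRing.isSemilinear.Build K cplx cplx *:%R
  (cplx_ext_fun f) (GRing.semilinear_linear (cplx_ext_linear f)).

Definition cplx_ext (f : 'End(L)) : 'End(cplx) := linfun (cplx_ext_fun f).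

Lemma cplx_inE x : cplx_in x = (x, 0).
Proof. exact: lfunE. Qed.

Lemma cplx_iE u : cplx_i u = (- u.2, u.1).
Proof. exact: lfunE. Qed.

Lemma cplx_extE f u : cplx_ext f u = (f u.1, f u.2).
Proof. by rewrite lfunE. Qed.

Variable f : involution L.

Fact cplx_extM u v : cplx_ext f (lie u v) = lie (cplx_ext f u) (cplx_ext f v).
Proof.
rewrite !cplx_extE; congr pair => /=; first by rewrite raddfB /= !involM.
by rewrite raddfD /= !involM.
Qed.

Fact cplx_extK u : cplx_ext f (cplx_ext f u) = u.
Proof. by case: u => u1 u2; rewrite !cplx_extE /= !involK. Qed.

Definition cplx_invol : involution cplx := Involution cplx_extM cplx_extK.

Lemma cplx_involE u : cplx_invol u = (f u.1, f u.2).
Proof. exact: cplx_extE. Qed.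

End Complexification.

Record commutative_triad (K : fieldType) := CommutativeTriad {
  triad_lie :> lieAlgType K;
  triad_inv1 : involution triad_lie;
  triad_inv2 : involution triad_lie;
  triad_commute : commuting triad_inv1 triad_inv2
}.

Section Dual.
Variables (K : fieldType) (L : lieAlgType K) (theta : involution L).

Definition dual_vs : {vspace cplx L} :=
  (cplx_in L @: leigenspace theta 1
   + cplx_i L @: (cplx_in L @: leigenspace theta (-1)))%VS.

Lemma mem_dual_vs (u : cplx L) :
  (u \in dual_vs) = (theta u.1 == u.1) && (theta u.2 == - u.2).
Proof.
apply/idP/andP.
  case/memv_addP=> _ /memv_imgP[x xT ->] [_ /memv_imgP[_ /memv_imgP[y yT ->] ->]].
  move: xT yT; rewrite !mem_leigenspace scale1r scaleN1r => /eqP xT /eqP yT ->.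
  by rewrite cplx_iE !cplx_inE /= oppr0 addr0 add0r xT yT !eqxx.
case: u => x y /= [xT yT].
have -> : (x, y) = cplx_in L x + cplx_i L (cplx_in L y) :> cplx L.
  by rewrite cplx_iE !cplx_inE; congr pair; rewrite /= ?oppr0 ?addr0 ?add0r.
by apply: memv_add; do 2?apply: memv_img;
  rewrite mem_leigenspace ?scale1r ?scaleN1r.
Qed.

Fact dual_closed (u v : cplx L) :
  u \in dual_vs -> v \in dual_vs -> lie u v \in dual_vs.
Proof.
rewrite !mem_dual_vs => /andP[/eqP u1 /eqP u2] /andP[/eqP v1 /eqP v2] /=.
rewrite raddfB raddfD /= !involM u1 u2 v1 v2.
by rewrite !(lieNl, lieNr) opprK opprD !eqxx.
Qed.

Definition dual_subalg : subalgebra (cplx L) := Subalgebra dual_closed.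

Definition dual_lie : lieAlgType K := sub_lie_alg dual_subalg.

Lemma dual_stable (sigma : involution L) :
  commuting theta sigma ->
  forall u, u \in dual_subalg -> cplx_invol sigma u \in dual_subalg.
Proof.
move=> ts u; rewrite !mem_dual_vs cplx_involE /= => /andP[/eqP u1 /eqP u2].
by rewrite !ts u1 u2 raddfN !eqxx.
Qed.

Lemma commuting_refl : commuting theta theta.
Proof. by []. Qed.

Variables (sigma : involution L) (ts : commuting theta sigma).

Definition dual_inv1 : involution dual_lie :=
  restrict (dual_stable commuting_refl).

Definition dual_inv2 : involution dual_lie := restrict (dual_stable ts).

Lemma val_dual_inv1 (u : dual_lie) :
  vsval (dual_inv1 u) = (theta (vsval u).1, theta (vsval u).2).
Proof. by rewrite [LHS](val_restrict (dual_stable commuting_refl)) cplx_involE. Qed.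

Lemma val_dual_inv2 (u : dual_lie) :
  vsval (dual_inv2 u) = (sigma (vsval u).1, sigma (vsval u).2).
Proof. by rewrite [LHS](val_restrict (dual_stable ts)) cplx_involE. Qed.

Fact dual_commute : commuting dual_inv1 dual_inv2.
Proof.
move=> u; apply: sub_lie_inj; rewrite val_dual_inv1 val_dual_inv2.
by rewrite val_dual_inv2 val_dual_inv1 /= !ts.
Qed.

Definition dual_triad : commutative_triad K := CommutativeTriad dual_commute.

End Dual.

Section RealLie.
Variables (R : realType) (g : lieAlgType R).

(* For semisimple [g], this means that [g] is the Lie algebra of a compact Lie
   group; it is not the right notion for algebras with a center. *)
Definition lie_compact : Prop := forall x : g, x != 0 -> killing x x < 0.

Definition cartan_involution (theta : involution g) : Prop :=
  forall x : g, x != 0 -> 0 < - killing x (theta x).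

Definition noncompact_semisimple : Prop := lie_semisimple g /\ ~ lie_compact.

End RealLie.

(* Main.v *)
From HB Require Import structures.
Require Import Defs.
From mathcomp Require Import all_boot all_order all_algebra.
From mathcomp Require Import reals.

Set Implicit Arguments.
Unset Strict Implicit.
Unset Printing Implicit Defensive.

Import Order.TTheory GRing.Theory Num.Theory passmx.
Local Open Scope ring_scope.

(** Write k + p for the eigenspace decomposition of g0 under theta, so that the
dual is g = k + i p. As vector spaces with involution g and g0 are the same, and
the brackets differ only by a sign when both arguments are anti-invariant; this
relation ([twisted_iso]) is symmetric in g and g0. Two kinds of data pass through
it in both directions:
- involution-stable ideals ([twisted_invol_simple]), because they are sums of
  homogeneous pieces and so do not see the sign;
- elements T of the centroid (linear maps with [Tx, y] = T[x, y]) which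
  anticommute with the involution, except that T^2 changes sign
  ([twisted_centroid]): concretely T is replaced by i T, which maps k + p to
  itself because T exchanges k and i p.

An algebra whose involution-stable ideals are trivial either is simple, or has a
proper nonzero ideal U and splits as the direct sum of U and its image under the
involution ([invol_simple_split]). In the second case the map T which is 1 on U
and -1 on its image lies in the centroid, has square 1 and anticommutes with the
involution ([split_centroid]); conversely no simple algebra carries such a T
([simple_centroid_anticommute]).

Suppose that g0 is simple. If g is not, it splits, and its T becomes on g0 a
centroid element with square -1, i.e. a complex structure.

Suppose that g is simple. Then stable ideals of g0 are trivial. Positivity of the
Cartan form excludes the splitting g0 = U + theta U: the two summands commute, so
the Killing form of x and theta x vanishes for x in U ([cartan_simple]). Positivity
also makes any complex structure J of g0 anticommute with theta
([complex_structure_anticommute]), so that J becomes on g a centroid element with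
square 1, which a simple algebra does not have. *)

(** * Ideals, involutions and the centroid *)

Section InvariantIdeals.
Variables (K : numFieldType) (L : lieAlgType K) (nu : involution L).
Implicit Types (U V : {vspace L}) (T : 'End(L)).

Definition centroid T : Prop := forall x y, lie (T x) y = T (lie x y).

Lemma centroidr T x y : centroid T -> lie x (T y) = T (lie x y).
Proof. by move=> cT; rewrite lie_antisym cT -raddfN /= -lie_antisym. Qed.

Lemma lie_ideall U x y : lie_ideal U -> x \in U -> lie x y \in U.
Proof. by move=> idU Ux; rewrite lie_antisym memvN idU. Qed.

Lemma disjoint_ideals_commute U V u v :
  lie_ideal U -> lie_ideal V -> (U :&: V = 0)%VS ->
  u \in U -> v \in V -> lie u v = 0.
Proof.
move=> idU idV UV0 Uu Vv; apply/eqP; rewrite -memv0 -UV0 memv_cap.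
by rewrite lie_ideall // idV.
Qed.

Lemma memv_img_invol U x : (x \in nu @: U)%VS = (nu x \in U).
Proof.
apply/memv_imgP/idP => [[u Uu ->]|Unx]; first by rewrite involK.
by exists (nu x); rewrite ?involK.
Qed.

Lemma invol_ideal U : lie_ideal U -> lie_ideal (nu @: U)%VS.
Proof. by move=> idU x y; rewrite !memv_img_invol involM => /idU. Qed.

(** Simplicity of the pair (L, nu): only the nu-stable ideals are required to be
trivial, so L may be the sum of two simple ideals exchanged by nu. *)
Definition invol_simple : Prop :=
  ~ lie_abelian L /\
  forall U, lie_ideal U -> (forall x, x \in U -> nu x \in U) ->
  U = 0%VS \/ U = fullv.

Lemma simple_invol_simple : lie_simple L -> invol_simple.
Proof. by case=> nabL simL; split=> // U /simL. Qed.

(** The intersection and the sum of U and nu U are nu-stable ideals, the first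
contained in U and the second containing it. *)
Lemma invol_simple_split U :
  invol_simple -> lie_ideal U -> U != 0%VS -> U != fullv ->
  (U :&: nu @: U = 0)%VS /\ (U + nu @: U)%VS = fullv.
Proof.
move=> [_ simL] idU U0 UL; have idnU := invol_ideal idU; split.
  case: (simL (U :&: nu @: U)%VS) => //.
  - by move=> x y /memv_capP[Uy nUy]; rewrite memv_cap idU ?idnU.
  - move=> x; rewrite !memv_cap !memv_img_invol involK => /andP[-> ->] //.
  - move=> capL; case/negP: UL; rewrite eqEsubv subvf -capL; exact: capvSl.
case: (simL (U + nu @: U)%VS) => //.
- move=> x _ /memv_addP[u Uu [v nUv ->]].
  by rewrite lieDr memv_add ?idU ?idnU.
- move=> _ /memv_addP[u Uu [v nUv ->]]; rewrite raddfD /= addrC.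
  by rewrite memv_add ?memv_img // -memv_img_invol.
- move=> add0; case/negP: U0; rewrite -subv0 -add0; exact: addvSl.
Qed.

(** T is 1 on U and -1 on nu U. It commutes with the bracket because U and nu U
are commuting ideals, and conjugation by nu exchanges its two eigenspaces. *)
Lemma split_centroid U :
  lie_ideal U -> (U :&: nu @: U = 0)%VS -> (U + nu @: U)%VS = fullv ->
  exists T, [/\ centroid T, forall x, T (T x) = x
              & forall x, T (nu x) = - nu (T x)].
Proof.
move=> idU UV0 UVL; have idV := invol_ideal idU.
pose P := daddv_pi U (nu @: U)%VS.
pose T := (2 *: P - \1)%VF.
have TE u v : u \in U -> v \in U -> T (u + nu v) = u - nu v.
  move=> Uu Uv; rewrite add_lfunE opp_lfunE scale_lfunE id_lfunE.
  have nUv : nu v \in (nu @: U)%VS by rewrite memv_img.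
  have -> : P (u + nu v) = u.
    rewrite raddfD /= daddv_pi_id //; apply/eqP; rewrite -subr_eq0 addrC addKr.
    have := daddv_pi_add UV0 (subvP (addvSr U _) _ nUv).
    rewrite [daddv_pi _ U _]daddv_pi_id ?(capvC _ U) // => /eqP.
    by rewrite -subr_eq0 addrK.
  by rewrite scaler_nat mulr2n opprD addrA addrK.
have dec x : exists u v, [/\ u \in U, v \in U & x = u + nu v].
  have /memv_addP[u Uu [v]] : x \in (U + nu @: U)%VS by rewrite UVL memvf.
  rewrite memv_img_invol => Uv ->; exists u, (nu v); split=> //.
  by rewrite involK.
exists T; split.
- move=> x y; have [u [v [Uu Uv ->]]] := dec x.
  have [a [b [Ua Ub ->]]] := dec y.
  have c w z : w \in U -> z \in U -> lie w (nu z) = 0.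
    move=> Uw Uz; apply: (disjoint_ideals_commute idU idV) => //.
    exact: memv_img.
  rewrite TE // !(lieDl, lieDr, lieNl) c // (lie_antisym (nu v)) c //.
  by rewrite oppr0 addr0 add0r -involM TE ?idU.
- move=> x; have [u [v [Uu Uv ->]]] := dec x.
  by rewrite TE // -raddfN /= TE ?memvN // raddfN /= opprK.
- move=> x; have [u [v [Uu Uv ->]]] := dec x.
  by rewrite TE // raddfD /= involK addrC TE // raddfB /= involK opprB.
Qed.

(** The eigenspace of T for 1 is an ideal, hence T is 1 or -1; a nonzero scalar
does not anticommute with nu on a nonzero space. *)
Lemma simple_centroid_anticommute T :
  lie_simple L -> centroid T -> (forall x, T (T x) = x) ->
  (forall x, T (nu x) = - nu (T x)) -> False.
Proof.
move=> [nabL simL] cT T2 Tnu; apply: nabL.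
have scal_abelian (a : K) : (forall x, T x = a *: x) -> a != 0 -> lie_abelian L.
  move=> Ta a0; have nu0 x : nu x = 0.
    have := Tnu x; rewrite !Ta linearZ /= => /eqP.
    rewrite -addr_eq0 -scalerDl -mulr2n scaler_eq0 mulrn_eq0 /= (negPf a0) /=.
    by move=> /eqP.
  by move=> x y; rewrite -[x](involK nu) nu0 lie_antisym lie0r oppr0.
case: (simL (leigenspace T 1)).
- move=> x y; rewrite !mem_leigenspace !scale1r => /eqP Ty.
  by rewrite -centroidr // Ty.
- move=> E0; apply: (scal_abelian (-1)); last by rewrite oppr_eq0 oner_eq0.
  move=> x; apply/eqP; rewrite scaleN1r -addr_eq0 -memv0 -E0 mem_leigenspace.
  by rewrite scale1r raddfD /= T2 addrC.
- move=> EL; apply: (scal_abelian 1); last exact: oner_neq0.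
  by move=> x; apply/eqP; rewrite -mem_leigenspace EL memvf.
Qed.

End InvariantIdeals.

(** * Changing the sign of the bracket of anti-invariant elements *)

Section Twist.
Variable K : numFieldType.

(** For x and y each in an eigenspace of nu, this is - lie x y when both are
anti-invariant and lie x y otherwise. The closed formula avoids decomposing
arbitrary elements into their homogeneous parts. *)
Definition twisted_lie (L : lieAlgType K) (nu : involution L) (x y : L) : L :=
  2^-1 *: (lie x y + lie (nu x) y + lie x (nu y) - lie (nu x) (nu y)).

Record twisted_iso (L M : lieAlgType K) (nu : involution L)
    (mu : involution M) (f : 'Hom(L, M)) (g : 'Hom(M, L)) : Prop := TwistedIso {
  twist_fK : cancel f g;
  twist_gK : cancel g f;
  twist_invol : forall x, f (nu x) = mu (f x);
  twist_lieE : forall x y, f (lie x y) = twisted_lie mu (f x) (f y)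
}.

Lemma addr_conj (V : lmodType K) (x y : V) : x + y + (x - y) = 2 *: x.
Proof. by rewrite addrACA subrr addr0 scaler_nat. Qed.

(** Changing the sign of the bracket of anti-invariant elements twice restores
the bracket. *)
Lemma twisted_iso_sym (L M : lieAlgType K) (nu : involution L)
    (mu : involution M) (f : 'Hom(L, M)) (g : 'Hom(M, L)) :
  twisted_iso nu mu f g -> twisted_iso mu nu g f.
Proof.
case=> fK gK fnu flie; split=> // [x|x y].
  by apply: (can_inj fK); rewrite gK fnu gK.
apply: (can_inj fK); rewrite gK /twisted_lie linearZ /= raddfB !raddfD /=.
rewrite !flie /twisted_lie !fnu !gK !involK -!scalerDr -scalerBr scalerA.
set a := lie x y; set b := lie (mu x) y; set c := lie x (mu y).
set d := lie (mu x) (mu y).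
have -> : a + b + c - d + (b + a + d - c) + (c + d + a - b) - (d + c + b - a)
          = 4 *: a.
  have <- : a + b - (c - d) = b + a + d - c by rewrite opprB addrA (addrC b).
  have <- : c + d - (a - b) = d + c + b - a by rewrite opprB addrA (addrC d).
  rewrite -[a + b + c - d]addrA addr_conj -addrA -[c + d + a - b]addrA.
  rewrite opprB [c + d + _]addrC addrACA subrr addr0 -mulr2n -scaler_nat.
  by rewrite -scalerDr addr_conj scalerA -natrM.
by rewrite scalerA -invfM -natrM mulVf ?scale1r ?pnatr_eq0.
Qed.

Section Transport.
Variables (L M : lieAlgType K) (nu : involution L) (mu : involution M).
Variables (f : 'Hom(L, M)) (g : 'Hom(M, L)).
Hypothesis fg : twisted_iso nu mu f g.

(** On a stable subspace U, [twisted_lie] takes values in U as soon as the bracket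
does, so the preimage under f of a stable ideal is again an ideal. *)
Lemma twisted_invol_simple : invol_simple nu -> invol_simple mu.
Proof.
case: fg => fK gK fnu flie; case: (twisted_iso_sym fg) => _ _ gmu glie.
case=> nabL simL; split=> [abM|U idU muU].
  apply: nabL => x y; apply: (can_inj fK); rewrite flie raddf0 /twisted_lie.
  by rewrite !abM !addr0 subr0 scaler0.
have memV x : (x \in f @^-1: U)%VS = (f x \in U) by rewrite -memv_preim.
case: (simL (f @^-1: U)%VS).
- move=> x y; rewrite !memV flie => Ufy.
  by rewrite memvZ // memvB ?memvD ?idU ?muU.
- by move=> x; rewrite !memV fnu => /muU.
- move=> V0; left; apply/eqP; rewrite -subv0; apply/subvP=> y Uy.
  rewrite memv0 -[y]gK -(raddf0 f) (inj_eq (can_inj fK)) -memv0 -V0 memV.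
  by rewrite gK.
- move=> VL; right; apply/vspaceP=> y.
  by rewrite memvf -[y]gK -memV VL memvf.
Qed.

(** Up to isomorphism M is the subspace of the complexification of L spanned by
the invariant x and the i y with y anti-invariant, f being 1 on the former and i
on the latter. As T exchanges the two eigenspaces, i T preserves this subspace:
it maps x to i (T x) and i y to - T y, so it is T \o nu carried over by f, whose
square is T nu T nu = - T^2. *)
Lemma twisted_centroid (T : 'End(L)) (e : K) :
  centroid T -> (forall x, T (nu x) = - nu (T x)) ->
  (forall x, T (T x) = e *: x) ->
  exists S : 'End(M), [/\ centroid S, forall x, S (mu x) = - mu (S x)
                        & forall x, S (S x) = - e *: x].
Proof.
case: fg => fK gK fnu flie; case: (twisted_iso_sym fg) => _ _ gmu glie.
move=> cT Tnu T2; exists (f \o (T \o (nu \o g)))%VF; split=> x.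
- move=> y; rewrite !comp_lfunE; apply: (can_inj gK); rewrite fK glie fK.
  rewrite glie; set a := g x; set b := g y; rewrite /twisted_lie.
  have -> : nu (T (nu a)) = - T a by rewrite Tnu raddfN /= involK.
  rewrite !lieNl !cT opprK -raddfB -!raddfD -linearZ /=; congr (T _).
  rewrite linearZ /= raddfB !raddfD /= !involM !involK.
  by rewrite (ACl (3*4*1*2)).
- by rewrite !comp_lfunE gmu Tnu raddfN /= fnu.
- rewrite !comp_lfunE fK (Tnu (T _)) T2 linearZ /= involK raddfN /=.
  by rewrite linearZ /= gK scaleNr.
Qed.

End Transport.
End Twist.

(** * Consequences of the positivity of the Cartan form *)

Section Cartan.
Variables (R : realType) (g : lieAlgType R) (theta : involution g).
Hypothesis theta_cartan : cartan_involution theta.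

Lemma cartan_eq0 x : 0 <= killing x (theta x) -> x = 0.
Proof.
move=> B0; apply/eqP/negPn/negP => /theta_cartan.
by rewrite oppr_gt0 ltNge B0.
Qed.

Lemma killing_eq0 (x y : g) :
  (forall z, lie x (lie y z) = 0) -> killing x y = 0.
Proof.
move=> xy0; rewrite /killing.
have -> : (ad x \o ad y)%VF = 0.
  by apply/lfunP=> z; rewrite comp_lfunE !lfunE /= xy0.
by rewrite raddf0 mxtrace0.
Qed.

Lemma killingNr (x y : g) : killing x (- y) = - killing x y.
Proof.
rewrite /killing -!raddfN /=; congr (\tr (mxof _ _ _)).
by apply/lfunP=> z; rewrite opp_lfunE !comp_lfunE !lfunE /= lieNl lieNr.
Qed.

Lemma killing_centroid (J : 'End(g)) (x y : g) :
  centroid J -> killing (J x) y = killing x (J y).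
Proof.
move=> cJ; rewrite /killing; congr (\tr (mxof _ _ _)).
by apply/lfunP=> z; rewrite !comp_lfunE !lfunE /= !cJ -centroidr.
Qed.

(** If g = U + theta U were a splitting into commuting ideals and x in U, then
ad (theta x) would kill U and map theta U to itself, where ad x vanishes: hence
killing x (theta x) = 0. *)
Lemma cartan_simple : invol_simple theta -> lie_simple g.
Proof.
move=> simg; split=> [|U idU]; first by case: simg.
have [->|U0] := eqVneq U 0%VS; first by left.
have [->|Ug] := eqVneq U fullv; first by right.
have [UV0 UVg] := invol_simple_split simg idU U0 Ug.
case/negP: U0; rewrite -subv0; apply/subvP=> x Ux; rewrite memv0; apply/eqP.
apply: cartan_eq0; rewrite killing_eq0 // => z.
have Vtx : theta x \in (theta @: U)%VS by rewrite memv_img.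
have comm := disjoint_ideals_commute idU (invol_ideal idU) UV0.
have /memv_addP[u Uu [v Vv ->]] : z \in (U + theta @: U)%VS by rewrite UVg memvf.
rewrite lieDr (lie_antisym _ u) (comm u) // oppr0 add0r comm //.
exact: invol_ideal.
Qed.

Lemma cartan_center0 (z : g) : (forall x, lie z x = 0) -> z = 0.
Proof. by move=> cz; apply: cartan_eq0; rewrite killing_eq0. Qed.

(** J' := theta J theta is the adjoint of J for the Cartan form, and commutes with
J since commutators of centroid elements take central values and the
center is zero. So J J' is a positive operator with square 1, hence J J' = 1 and J' = - J. In the proof this
reads: J x + J' x is fixed by J^-1 J', and for y fixed by J^-1 J' the Cartan
form takes opposite values at y and at J y. *)
Lemma complex_structure_anticommute (J : 'End(g)) :
  complex_structure J -> forall x, J (theta x) = - theta (J x).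
Proof.
move=> [J2 cJ]; pose J' := (theta \o (J \o theta))%VF.
have J'E x : J' x = theta (J (theta x)) by rewrite !comp_lfunE.
have J'2 x : J' (J' x) = - x.
  by rewrite !J'E involK J2 raddfN /= involK.
have cJ' : centroid J'.
  by move=> x y; rewrite !J'E involM -cJ involM involK.
have JJ' x : J (J' x) = J' (J x).
  apply/eqP; rewrite -subr_eq0; apply/eqP/cartan_center0 => y.
  rewrite lieBl; apply/eqP; rewrite subr_eq0; apply/eqP.
  by rewrite cJ -(centroidr _ _ cJ) !cJ' cJ centroidr.
have fix0 y : J' y = J y -> y = 0.
  move=> eqJ; have [//|y0] := eqVneq y 0; have Jy0 : J y != 0.
    by apply: contra_neq y0 => Jy0; rewrite -[y]opprK -(J2 y) Jy0 raddf0 oppr0.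
  have := theta_cartan Jy0; rewrite oppr_gt0 killing_centroid //.
  have <- : theta (J' (J y)) = J (theta (J y)) by rewrite J'E involK.
  rewrite -eqJ J'2 raddfN /= killingNr oppr_lt0 ltNge => /negP[].
  by rewrite ltW // -oppr_gt0 theta_cartan.
move=> x; apply/eqP; rewrite -addr_eq0; apply/eqP.
have := fix0 (J x + J' x); rewrite !raddfD /= J2 J'2 JJ' addrC => /(_ erefl).
rewrite J'E => /(congr1 theta); rewrite raddfD /= involK raddf0 => <-.
by rewrite addrC.
Qed.

End Cartan.

(** * The dual as a twisted form *)

Section DualTwist.
Variables (K : numFieldType) (L : lieAlgType K) (theta : involution L).
Let g := dual_lie theta.

(** The map k + i p -> k + p which forgets i. *)
Definition dual_to_fun (u : g) : L := (vsval u).1 + (vsval u).2.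

Fact dual_to_linear : linear dual_to_fun.
Proof.
by move=> a u v; rewrite /dual_to_fun val_sub_lieP /= scalerDr addrACA.
Qed.
HB.instance Definition _ := GRing.isSemilinear.Build K g L *:%R dual_to_fun
  (GRing.semilinear_linear dual_to_linear).

Definition dual_of_fun (x : L) : g :=
  vsproj (dual_vs theta) (2^-1 *: (x + theta x), 2^-1 *: (x - theta x)).

Lemma val_dual_of x :
  vsval (dual_of_fun x) = (2^-1 *: (x + theta x), 2^-1 *: (x - theta x)).
Proof.
rewrite vsprojK // mem_dual_vs /= !linearZ /= raddfB raddfD /= involK.
by rewrite addrC opprB !eqxx.
Qed.

Fact dual_of_linear : linear dual_of_fun.
Proof.
move=> a x y; apply: sub_lie_inj.
rewrite val_sub_lieP !val_dual_of linearP; congr pair => /=;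
  rewrite [RHS]addrC scalerA mulrC -scalerA -scalerDr; congr (_ *: _).
  by rewrite scalerDr addrACA addrC.
by rewrite opprD scalerBr addrACA addrC.
Qed.
HB.instance Definition _ := GRing.isSemilinear.Build K L g *:%R dual_of_fun
  (GRing.semilinear_linear dual_of_linear).

(** For u = a + i b and v = c + i d the bracket in the dual differs from that of
a + b and c + d only by the sign of lie b d, which comes from i^2 = -1. *)
Lemma dual_twisted_iso :
  twisted_iso (dual_inv1 theta) theta (linfun dual_to_fun) (linfun dual_of_fun).
Proof.
have half (x : L) : 2^-1 *: (x + x) = x.
  by rewrite -mulr2n -scaler_nat scalerA mulVf ?scale1r ?pnatr_eq0.
have thE (u : g) :
    theta (vsval u).1 = (vsval u).1 /\ theta (vsval u).2 = - (vsval u).2.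
  by have := subvsP u; rewrite mem_dual_vs => /andP[/eqP-> /eqP->].
have toE u : linfun dual_to_fun u = (vsval u).1 + (vsval u).2 by rewrite lfunE.
have ofE x : linfun dual_of_fun x = dual_of_fun x by rewrite lfunE.
split=> [u|x|u|u v]; rewrite !(toE, ofE).
- apply: sub_lie_inj; rewrite val_dual_of (raddfD (invol_fun theta)) /=.
  have [-> ->] := thE u; rewrite addrACA subrr addr0 half opprD opprK.
  by rewrite addrACA subrr add0r half; case: (vsval u).
- by rewrite val_dual_of -scalerDr addrACA subrr addr0 half.
- by rewrite val_dual_inv1 raddfD.
- rewrite val_sub_lie /twisted_lie !(raddfD (invol_fun theta)) /=.
  have [-> ->] := thE u; have [-> ->] := thE v.
  set a := (vsval u).1; set b := (vsval u).2.
  set c := (vsval v).1; set d := (vsval v).2.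
  rewrite !(lieDl, lieDr, lieNl, lieNr).
  set p := lie a c; set q := lie a d; set r := lie b c; set s := lie b d.
  have -> : p - r + (q - s) = p + q - (r + s) by rewrite opprD addrACA.
  rewrite addr_conj -[_ + _ - (p - q - _)]addrA.
  have -> : p - q + (r - s) - (p - q - (r - s)) = 2 *: (r - s).
    by rewrite opprB [p - q + _]addrC addr_conj.
  rewrite -scalerDr scalerA mulVf ?scale1r ?pnatr_eq0 //.
  by rewrite [p - s + _]addrACA [- s + r]addrC.
Qed.

End DualTwist.

Theorem proposition4p17 (R : realType) (g0 : lieAlgType R)
    (sigma theta : involution g0)
    (g0_ncss : noncompact_semisimple g0)
    (theta_cartan : cartan_involution theta)
    (theta_sigma : commuting theta sigma) :
  lie_simple (dual_triad theta_sigma) <->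
  lie_simple g0 /\ ~ (exists J : 'End(g0), complex_structure J).
Proof.
have iso := dual_twisted_iso theta; have iso' := twisted_iso_sym iso.
split=> [simg|[simg0 noJ]].
- have simg0 : lie_simple g0.
    apply: (cartan_simple theta_cartan); apply: (twisted_invol_simple iso).
    exact: simple_invol_simple.
  split=> // -[J csJ]; have [J2 cJ] := csJ.
  have Jth := complex_structure_anticommute theta_cartan csJ.
  have [|T [cT Tth T2]] := twisted_centroid (e := -1) iso' cJ Jth.
    by move=> x; rewrite scaleN1r.
  apply: (simple_centroid_anticommute simg cT _ Tth) => x.
  by rewrite T2 opprK scale1r.
have simg : invol_simple (dual_inv1 theta).
  exact/(twisted_invol_simple iso')/simple_invol_simple.
split=> [|U idU]; first by case: simg.
have [->|U0] := eqVneq U 0%VS; first by left.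
have [->|Ug] := eqVneq U fullv; first by right.
have [UV0 UVg] := invol_simple_split simg idU U0 Ug.
have [T [cT T2 Tth]] := split_centroid idU UV0 UVg.
have [|J [cJ _ J2]] := twisted_centroid (e := 1) iso cT Tth.
  by move=> x; rewrite scale1r.
by case: noJ; exists J; split=> // x; rewrite J2 scaleN1r.
Qed.
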